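(* Let $d\in\{2,3\}$ and let $K\subset\mathbb{R}^d$ be a convex body that has a minimal width direction in which it is spiky; that is, there is a minimal width direction $u\in S^{d-1}$ of $K$ such that $K$ is spiky in direction $u$. Then for every $\varepsilon\in(0,1)$ there exists $y\in\mathbb{R}^d$ with $\varepsilon K+y\subset \operatorname{int}K$ such that $K\setminus(\varepsilon K+y)$ can be covered by finitely many planks whose total width is strictly less than $w(K)$.
   Context: A convex body in $\mathbb{R}^d$ is a convex, compact set with nonempty interior. A plank is the closed region of $\mathbb{R}^d$ between two parallel hyperplanes; the distance between these hyperplanes is the width of the plank. The total width of a finite family of planks is the sum of their widths. The minimal width $w(K)$ of a convex body $K$ is the smallest possible width of a single plank that covers $K$; a plank of this width covering $K$ is a minimal width plank of $K$. A unit vector $u\in S^{d-1}$ is a minimal width direction of $K$ if it is a normal vector to the bounding hyperplanes of some minimal width plank of $K$, i.e. $h_K(u)+h_K(-u)=w(K)$, where $h_K(u)=\max_{x\in K}\langle x,u\rangle$ is the support function. For $u\in S^{d-1}$, the supporting hyperplane of $K$ with outer normal $u$ is $H_K(u)=\{x\in\mathbb{R}^d : \langle x,u\rangle=h_K(u)\}$. For $x\in\partial K$, the tangent cone of $K$ at $x$ is $T_K(x)=\operatorname{cl}\{x+\alpha(y-x) : y\in K,\ \alpha\ge 0\}$, where $\operatorname{cl}$ denotes closure. $K$ is spiky in direction $u\in S^{d-1}$ if $K\cap H_K(u)$ is a single point $x\in\partial K$ and $T_K(x)\cap H_K(u)=\{x\}$. Here $\operatorname{int}$ denotes interior, and $\varepsilon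 K+y=\{\varepsilon x+y: x\in K\}$. *)

(* Defs.v *)
From mathcomp Require Import all_boot all_order all_algebra.
From mathcomp Require Import all_classical all_reals all_analysis.
Import Order.TTheory GRing.Theory Num.Theory.
Import numFieldNormedType.Exports.

Set Implicit Arguments.
Unset Strict Implicit.
Unset Printing Implicit Defensive.

Local Open Scope classical_set_scope.
Local Open Scope ring_scope.

(* Points of R^d are row vectors 'rV[R]_d.  The library norm on 'rV[R]_d is the
   sup norm, so the Euclidean structure is given by [dot]; the topology
   (compactness, interior, closure) is the same for both norms. *)
Definition dot (R : realType) (d : nat) (x y : 'rV[R]_d) : R :=
  \sum_(i < d) x ord0 i * y ord0 i.

Definition unit_sphere (R : realType) (d : nat) : set 'rV[R]_d :=
  [set u | dot u u = 1].

Definition convex_body (R : realType) (d : nat) (K : set 'rV[R]_d) : Prop :=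
  [/\ convex_set (M := 'rV[R]_d) K, compact K & interior K !=set0].

(* The hyperplanes <x, normal> = lo and <x, normal> = hi bound the plank; as the
   normal is a unit vector, their distance is hi - lo.  The bounding hyperplanes
   are distinct, so that widths are positive. *)
Record plank (R : realType) (d : nat) := Plank {
  normal : 'rV[R]_d;
  lo : R;
  hi : R;
  normal_unit : unit_sphere normal;
  lo_lt_hi : lo < hi }.

Definition plank_set (R : realType) (d : nat) (P : plank R d) :
    set 'rV[R]_d :=
  [set x | lo P <= dot x (normal P) <= hi P].

Definition plank_width (R : realType) (d : nat) (P : plank R d) : R :=
  hi P - lo P.

Definition minimal_width (R : realType) (d : nat) (K : set 'rV[R]_d) : R :=
  inf [set plank_width P | P in [set P : plank R d | K `<=` plank_set P]].

Definition minimal_width_plank (R : realType) (d : nat) (K : set 'rV[R]_d)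
    (P : plank R d) : Prop :=
  K `<=` plank_set P /\ plank_width P = minimal_width K.

(* The choice of sign of the normal is immaterial: (- u, - hi, - lo) describes
   the same plank as (u, lo, hi). *)
Definition minimal_width_direction (R : realType) (d : nat)
    (K : set 'rV[R]_d) (u : 'rV[R]_d) : Prop :=
  exists P : plank R d, minimal_width_plank K P /\ normal P = u.

Definition support_function (R : realType) (d : nat) (K : set 'rV[R]_d)
    (u : 'rV[R]_d) : R :=
  sup [set dot x u | x in K].

Definition supporting_hyperplane (R : realType) (d : nat) (K : set 'rV[R]_d)
    (u : 'rV[R]_d) : set 'rV[R]_d :=
  [set x | dot x u = support_function K u].

Definition boundary (R : realType) (d : nat) (K : set 'rV[R]_d) :
    set 'rV[R]_d :=
  closure K `\` interior K.

Definition tangent_cone (R : realType) (d : nat) (K : set 'rV[R]_d)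
    (x : 'rV[R]_d) : set 'rV[R]_d :=
  closure [set z | exists2 y, K y & exists2 a : R, 0 <= a & z = x + a *: (y - x)].

Definition spiky (R : realType) (d : nat) (K : set 'rV[R]_d)
    (u : 'rV[R]_d) : Prop :=
  exists x : 'rV[R]_d,
    [/\ boundary K x,
        K `&` supporting_hyperplane K u = [set x] &
        tangent_cone K x `&` supporting_hyperplane K u = [set x]].

Definition homothet (R : realType) (d : nat) (e : R) (K : set 'rV[R]_d)
    (y : 'rV[R]_d) : set 'rV[R]_d :=
  [set e *: x + y | x in K].

(* Main.v *)
Require Import Defs.
From mathcomp Require Import all_boot all_order all_algebra.
From mathcomp Require Import all_classical all_reals all_analysis.
From mathcomp Require Import ring lra.
Import Order.TTheory GRing.Theory Num.Theory.
Import numFieldNormedType.Exports.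

(** Put the spike [x] at the origin and measure depth by [dot p a], where
    [a = - u] points from the spike into the body.  Spikiness says that the
    closed cone [D] spanned by [K] has bounded slices of constant depth.

    Cover everything at depth at least [t] by one plank of width [w - t], [w]
    being the minimal width.  What is left must be covered by planks of total
    width less than [t], and for small [t] it lies near the lateral boundary of
    [D], truncated at depth [t]: at that scale both [K] and its homothet look
    like [D].  So everything rests on the scale-free claim that the boundary of
    [D] up to depth 1 lies in finitely many open strips around hyperplanes
    through the apex, of total width less than 1
    ([planar_boundary_covered], [spatial_boundary_covered]).

    In the plane the boundary consists of two rays and the claim is clear.  In
    space it is the cone over the boundary of a planar convex set.  Up to two
    thin end strips that boundary is made of the graph of a concave function
    and that of a convex one.  Replacing such a graph by chords over a grid of
    step [l] costs at most the decrease of the increments from each grid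
    interval to the next; these decreases telescope, so the total cost is
    O(l) ([concave_graph_strips]).  A planar strip becomes a spatial one by
    coning, since at depth at most 1 the cone is only thinner.  From dimension
    4 on the boundary of the section is a surface, and the count of caps no
    longer beats their heights.

    The part of the truncated cone outside the open strips is compact and lies
    in the cone [O] spanned by the interior of [K].  Hence it is contained in
    a large multiple [K / b] of [K], even shifted slightly inward
    ([compact_sub_open_cone]).  Scaling by [t = e * b] turns this into: a point
    of [K] at depth at most [t] outside the scaled strips belongs to the
    homothet of ratio [e] with its spike moved slightly inside [K].  The inward
    shift is what puts this homothet in the interior of [K]. *)

Local Open Scope classical_set_scope.
Local Open Scope ring_scope.

Set Implicit Arguments.
Unset Strict Implicit.
Unset Printing Implicit Defensive.

(** * Strips covering the graph of a concave function *)

(** The usual three-point inequality with denominators cleared, so that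
    degenerate triples need no side condition. *)
Definition concave_on (R : realType) (a b : R) (g : R -> R) :=
  forall x y z, a <= x -> x <= y -> y <= z -> z <= b ->
    g x * (z - y) + g z * (y - x) <= g y * (z - x).

Lemma grid_bracket (R : realType) (u : nat -> R) (n : nat) (x : R) :
  u 0%N <= x -> x <= u n.+1 -> exists i : 'I_n.+1, u i <= x <= u i.+1.
Proof.
move=> u0; elim: n => [|n IH] xu; first by exists ord0; rewrite u0.
have [xn|/ltW nx] := leP x (u n.+1); last by exists ord_max; rewrite nx.
have [i] := IH xn; by exists (widen_ord (leqnSn _) i).
Qed.

(** On the grid [y k] of step [l], concavity traps the graph over one interval
    between its chord and the prolonged chord of the preceding interval; their
    gap is at most [D i - D i.+1] with [D i] the increments of [g].  The gaps
    telescope to a difference of two increments, and the margin [eta] at both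
    ends makes each increment O(l): its slope is bounded by that of a chord of
    length at least [eta]. *)
Lemma concave_graph_strips (R : realType) (g : R -> R) (a b M eta kappa : R) :
  0 < eta -> 0 < kappa -> a + 2 * eta < b ->
  (forall x, a <= x <= b -> `|g x| <= M) -> concave_on a b g ->
  exists (n : nat) (A B h : 'I_n -> R),
    [/\ forall i, 0 < h i, \sum_i h i < kappa &
        forall x, a + eta <= x <= b - eta ->
          exists i, `|g x - (A i * x + B i)| < h i].
Proof.
move=> eta0 kappa0 ab gM gc.
have M0 : 0 <= M.
  by apply: le_trans (gM a _) => //; apply/andP; split; lra.
pose L := b - a - 2 * eta; have L0 : 0 < L by rewrite /L; lra.
pose n := Num.trunc (Num.max (L / eta) (8 * M * L / (eta * kappa))).
have := truncnS_gt (Num.max (L / eta) (8 * M * L / (eta * kappa))).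
rewrite -/n gt_max => /andP[n1 n2].
have n0 : 0 < n.+1%:R :> R by rewrite ltr0n.
pose l := L / n.+1%:R; have l0 : 0 < l by rewrite divr_gt0.
have lL : l * n.+1%:R = L by rewrite /l divfK ?gt_eqF.
have l_eta : l <= eta.
  rewrite /l ler_pdivrMr // -ler_pdivrMl // mulrC; exact: ltW.
have l_kappa : 4 * M * l / eta < kappa / 2.
  rewrite /l ltr_pdivrMr // mulrA ltr_pdivrMr //.
  move: n2; rewrite ltr_pdivrMr ?mulr_gt0 //.
  lra.
(* The grid starts one step before [a + eta], so that the first interval of
   interest also has a predecessor. *)
pose y k := a + eta - l + k%:R * l.
have yS k : y k.+1 = y k + l by rewrite /y -natr1; ring.
have y0 : y 0%N = a + eta - l by rewrite /y; ring.
have yN : y n.+1 = b - eta - l by rewrite /y mulrC lL /L; ring.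
have yge k : a <= y k.
  rewrite /y; have := mulr_ge0 (ler0n R k) (ltW l0); lra.
have yle k : (k <= n.+2)%N -> y k <= b - eta.
  move=> kn; have : y k <= y n.+2.
    by rewrite /y lerD2l ler_wpM2r ?ler_nat // ltW.
  by rewrite yS yN; lra.
pose D k := g (y k.+1) - g (y k).
have yb k : (k <= n.+2)%N -> y k <= b by move=> kn; have := yle k kn; lra.
have Ddec k : (k < n.+1)%N -> D k.+1 <= D k.
  move=> kn; have := gc (y k) (y k.+1) (y k.+2) (yge k).
  have := yb k.+2; rewrite !yS /D !yS => /(_ kn) h1 h2.
  have {}h2 := h2 ltac:(lra) ltac:(lra) h1.
  rewrite -(ler_pM2l l0); lra.
exists n.+1, (fun i => D i.+1 / l),
  (fun i => g (y i.+1) - D i.+1 / l * y i.+1),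
  (fun i => D i - D i.+1 + kappa / 2 / n.+1%:R).
split=> [i||x /andP[ax xb]].
- by rewrite ltr_wpDl ?subr_ge0 ?Ddec // !divr_gt0.
- rewrite big_split /= sumr_const card_ord -[X in _ + X]mulr_natr divfK ?gt_eqF //.
  rewrite -(big_mkord xpredT (fun i => D i - D i.+1)).
  under eq_bigr do rewrite -opprB.
  rewrite sumrN telescope_sumr // opprB.
  suff [h1 h2] : D 0%N <= 2 * M * l / eta /\ - D n.+1 <= 2 * M * l / eta by lra.
  have bnd z z' : a <= z <= b -> a <= z' <= b -> g z - g z' <= 2 * M.
    move=> /gM; rewrite ler_norml => /andP[? ?].
    by move=> /gM; rewrite ler_norml => /andP[? ?]; lra.
  split; rewrite ler_pdivlMr //.
  + have := gc a (y 0%N) (y 1%N) (lexx a) (yge _).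
    rewrite /D !yS => /(_ ltac:(lra) ltac:(lra)) h.
    have := bnd (y 0%N + l) a ltac:(lra) ltac:(lra).
    rewrite -(ler_pM2l l0) => h'.
    move: h h'; set p := g (_ + _); rewrite !y0; set q := g (_ - _).
    lra.
  + have := gc (y n.+1) (y n.+2) b (yge _).
    rewrite /D (yS n.+1) yN => /(_ ltac:(lra) ltac:(lra) (lexx b)) h.
    have h' := bnd (b - eta - l + l) b ltac:(lra) ltac:(lra).
    rewrite -(ler_pM2l l0) in h'; lra.
have [||i /andP[x1 x2]] := @grid_bracket R (fun k => y k.+1) n x.
- by rewrite yS y0; lra.
- by rewrite yS yN; lra.
exists i.
have in2 : (i.+2 <= n.+2)%N by rewrite !ltnS; have := ltn_ord i.
have xb2 := yb _ in2.
have := gc (y i) (y i.+1) x (yge i).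
have := gc (y i.+1) x (y i.+2) (yge i.+1) x1 x2 xb2.
rewrite /D; move: x1 x2; rewrite !yS.
set p := g (y i); set q := g (_ + l); set r := g (_ + l + l) => x1 x2 lo up.
have {}up := up ltac:(lra) ltac:(lra) ltac:(lra).
set k := kappa / 2 / _; have k0 : 0 < k by rewrite !divr_gt0.
pose s := (x - (y i + l)) / l.
have s0 : 0 <= s by rewrite divr_ge0 ?(ltW l0) //; lra.
have s1 : s <= 1 by rewrite ler_pdivrMr // mul1r; lra.
have sl z : z * (s * l) = z * (x - (y i + l)) by rewrite /s divfK ?gt_eqF.
have -> : (r - q) / l * x + (q - (r - q) / l * (y i + l)) = q + s * (r - q).
  by rewrite /s; field; rewrite gt_eqF.
have lo' : q * (1 - s) + r * s <= g x.
  by rewrite -(ler_pM2l l0); have := sl q; have := sl r; lra.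
have up' : g x <= q + s * (q - p).
  by rewrite -(ler_pM2l l0); have := sl q; have := sl p; lra.
have : q + s * (q - p) - (q + s * (r - q)) <= q - p - (r - q).
  have : 0 <= (1 - s) * ((q - p) - (r - q)).
    rewrite mulr_ge0 ?subr_ge0 //.
    have := Ddec i (ltn_ord i); rewrite /D !yS; exact.
  lra.
rewrite ltr_norml => ?; apply/andP; split; last by lra.
have : q * (1 - s) + r * s = q + s * (r - q) by ring.
have : 0 <= (q - p) - (r - q).
    have := Ddec i (ltn_ord i); rewrite /D !yS subr_ge0; exact.
by lra.
Qed.

(** * Inner product and orthonormal frames *)

Lemma dotC (R : realType) (d : nat) (x y : 'rV[R]_d) : dot x y = dot y x.
Proof. by apply: eq_bigr => i _; rewrite mulrC. Qed.

Lemma dotDl (R : realType) (d : nat) (x y z : 'rV[R]_d) :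
  dot (x + y) z = dot x z + dot y z.
Proof. by rewrite -big_split; apply: eq_bigr => i _; rewrite mxE mulrDl. Qed.

Lemma dotZl (R : realType) (d : nat) (c : R) (x z : 'rV[R]_d) :
  dot (c *: x) z = c * dot x z.
Proof. by rewrite /dot mulr_sumr; apply: eq_bigr => i _; rewrite mxE mulrA. Qed.

Lemma dotNl (R : realType) (d : nat) (x z : 'rV[R]_d) : dot (- x) z = - dot x z.
Proof. by rewrite -scaleN1r dotZl mulN1r. Qed.

Lemma dotBl (R : realType) (d : nat) (x y z : 'rV[R]_d) :
  dot (x - y) z = dot x z - dot y z.
Proof. by rewrite dotDl dotNl. Qed.

Lemma dot0l (R : realType) (d : nat) (z : 'rV[R]_d) : dot 0 z = 0.
Proof. by rewrite -[X in dot X _](scale0r 0) dotZl mul0r. Qed.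

Lemma dotDr (R : realType) (d : nat) (x y z : 'rV[R]_d) :
  dot z (x + y) = dot z x + dot z y.
Proof. by rewrite ![dot z _]dotC dotDl. Qed.

Lemma dotZr (R : realType) (d : nat) (c : R) (x z : 'rV[R]_d) :
  dot z (c *: x) = c * dot z x.
Proof. by rewrite ![dot z _]dotC dotZl. Qed.

Lemma dotNr (R : realType) (d : nat) (x z : 'rV[R]_d) : dot z (- x) = - dot z x.
Proof. by rewrite ![dot z _]dotC dotNl. Qed.

Lemma dotBr (R : realType) (d : nat) (x y z : 'rV[R]_d) :
  dot z (x - y) = dot z x - dot z y.
Proof. by rewrite dotDr dotNr. Qed.

Definition dotE := (dotDl, dotBl, dotZl, dotNl, dotDr, dotBr, dotZr, dotNr).

Lemma dot_gt0 (R : realType) (d : nat) (x : 'rV[R]_d) : x != 0 -> 0 < dot x x.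
Proof.
move=> x0; rewrite lt_neqAle eq_sym sumr_ge0 ?andbT; last first.
  by move=> i _; rewrite -expr2 sqr_ge0.
apply: contraNN x0; rewrite psumr_eq0 => [/allP z|i _]; last first.
  by rewrite -expr2 sqr_ge0.
apply/eqP/rowP => i; rewrite mxE; apply/eqP.
by have := z i (mem_index_enum _); rewrite mulf_eq0 orbb.
Qed.

Lemma dot_continuous (R : realType) (d : nat) (z : 'rV[R]_d) :
  continuous (fun x : 'rV[R]_d => dot x z).
Proof.
rewrite /dot; elim: (index_enum _) => [|i s IH].
  by under eq_fun do rewrite big_nil; exact: cst_continuous.
under eq_fun do rewrite big_cons.
move=> x; apply: (@continuousD _ _ _ (fun y : 'rV[R]_d => y ord0 i * z ord0 i)
  (fun y => \sum_(j <- s) y ord0 j * z ord0 j)); last exact: IH.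
by apply: continuousM; [exact: coord_continuous|exact: cst_continuous].
Qed.

Lemma dot_le_norm (R : realType) (d : nat) (z : 'rV[R]_d) :
  exists2 C : R, 0 <= C & forall x : 'rV[R]_d, `|dot x z| <= C * `|x|.
Proof.
exists (\sum_(i < d) `|z ord0 i|) => [|x]; first exact: sumr_ge0.
rewrite /dot mulr_suml; apply: le_trans (ler_norm_sum _ _ _) _.
apply: ler_sum => i _; rewrite normrM mulrC ler_wpM2l //.
by rewrite [leRHS]/Num.Def.normr /= mx_normrE; apply: (le_bigmax _ _ (ord0, i)).
Qed.

(** Fewer than [d] linear conditions have a nonzero solution: the kernel of the
    matrix with these columns is nontrivial by its rank. *)
Lemma exists_unit_orthogonal (R : realType) (d k : nat) (w : 'I_k -> 'rV[R]_d) :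
  (k < d)%N -> exists v, dot v v = 1 /\ forall i, dot v (w i) = 0.
Proof.
move=> kd; pose A := (\matrix_(i < k) w i)^T.
have : kermx A != 0.
  rewrite -mxrank_eq0 mxrank_ker subn_eq0 -ltnNge.
  exact: leq_ltn_trans (rank_leq_col _) kd.
set v := nz_row (kermx A); rewrite -nz_row_eq0 => v0.
have vA : v *m A = 0 by apply/eqP; rewrite -sub_kermx nz_row_sub.
have n0 : 0 < Num.sqrt (dot v v) by rewrite sqrtr_gt0 dot_gt0.
exists ((Num.sqrt (dot v v))^-1 *: v); split=> [|i].
  rewrite !dotE mulrA -invfM -expr2 sqr_sqrtr ?ltW ?dot_gt0 //.
  by rewrite mulVf // gt_eqF // dot_gt0.
rewrite dotZl; suff -> : dot v (w i) = 0 by rewrite mulr0.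
transitivity ((v *m A) ord0 i); last by rewrite vA mxE.
by rewrite mxE; apply: eq_bigr => j _; rewrite !mxE.
Qed.

(** The matrix [W] of the frame satisfies [W *m W^T = 1], which already makes
    [W^T] invertible. *)
Lemma orthonormal_complete (R : realType) (d : nat) (w : 'I_d -> 'rV[R]_d) :
  (forall i j, dot (w i) (w j) = (i == j)%:R) ->
  forall p, (forall i, dot p (w i) = 0) -> p = 0.
Proof.
move=> ww p pw; pose W := \matrix_(i < d) w i.
have dotW (v : 'rV[R]_d) i : (v *m W^T) ord0 i = dot v (w i).
  by rewrite mxE; apply: eq_bigr => j _; rewrite !mxE.
have WW : W *m W^T = 1%:M.
  apply/matrixP => i j; rewrite mxE [RHS]mxE -ww.
  by apply: eq_bigr => l _; rewrite !mxE.
have [_ Wu] := mulmx1_unit WW.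
have : p *m W^T = 0 by apply/rowP => i; rewrite dotW mxE.
by move/(congr1 (mulmx^~ (invmx W^T))); rewrite mulmxK // mul0mx.
Qed.

Lemma plane_frame (R : realType) (a : 'rV[R]_2) :
  dot a a = 1 -> exists e, [/\ dot e e = 1, dot e a = 0 &
    forall p, dot p a = 0 -> dot p e = 0 -> p = 0].
Proof.
move=> a1; have [e [e1 ea]] := @exists_unit_orthogonal R 2 1 (fun=> a) isT.
have {}ea := ea ord0; exists e; split=> // p pa pe.
pose w (i : 'I_2) := nth 0 [:: a; e] i.
apply: (@orthonormal_complete R 2 w) => [i j|i].
  by case: i => [[|[|//]]] ?; case: j => [[|[|//]]] ?;
    rewrite /w /= -?val_eqE /= // dotC.
by case: i => [[|[|//]]] ?; rewrite /w /=.
Qed.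

Lemma space_frame (R : realType) (a : 'rV[R]_3) :
  dot a a = 1 -> exists e f, [/\ dot e e = 1, dot f f = 1 &
    [/\ dot e a = 0, dot f a = 0, dot f e = 0 &
    forall p, dot p a = 0 -> dot p e = 0 -> dot p f = 0 -> p = 0]].
Proof.
move=> a1; have [e [e1 ea]] := @exists_unit_orthogonal R 3 1 (fun=> a) isT.
have {}ea := ea ord0.
have [f [f1 fae]] := @exists_unit_orthogonal R 3 2 (fun i => nth 0 [:: a; e] i) isT.
have fa := fae ord0; have fe := fae ord_max; rewrite /= in fa fe.
exists e, f; split=> //; split=> // p pa pe pf.
pose w (i : 'I_3) := nth 0 [:: a; e; f] i.
apply: (@orthonormal_complete R 3 w) => [i j|i].
  by case: i => [[|[|[|//]]]] ?; case: j => [[|[|[|//]]]] ?;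
    rewrite /w /= -?val_eqE /= // dotC.
by case: i => [[|[|[|//]]]] ?; rewrite /w /=.
Qed.

(** * Sharp cones *)

(** [D] plays the closed cone spanned by a convex body at a spike, [O] the cone
    spanned by its interior, and [a] the inward axis.  [cone_absorb] is the
    form in which convexity is used; [cone_bound] says that the slices of
    constant depth [dot p a] are bounded. *)
Record sharp_cone (R : realType) (d : nat) (a : 'rV[R]_d)
    (O D : set 'rV[R]_d) : Prop := SharpCone {
  cone_open : open O;
  cone_nonempty : O !=set0;
  cone_sub : O `<=` D;
  cone_absorb : forall o p, O o -> D p -> O (o + p);
  cone_scale_open : forall c o, 0 < c -> O o -> O (c *: o);
  cone_scale : forall c p, 0 <= c -> D p -> D (c *: p);
  cone_bound : exists2 C, 0 < C & forall p, D p -> `|p| <= C * dot p a }.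

Lemma open_dir (R : realType) (d : nat) (O : set 'rV[R]_d) (o v : 'rV[R]_d) :
  open O -> O o -> exists2 r : R, 0 < r & O (o + r *: v) /\ O (o - r *: v).
Proof.
move=> oO Oo.
have cf : {for 0, continuous (fun r : R => o + r *: v)}.
  apply: (@continuousD _ _ _ (fun=> o) (fun r : R => r *: v)).
    exact: cst_continuous.
  exact: scalel_continuous.
have : nbhs (0 : R) ((fun r : R => o + r *: v) @^-1` O).
  apply: cf; rewrite scale0r addr0; exact: open_nbhs_nbhs.
move=> /nbhs_ballP[r /= r0 rO]; exists (r / 2); first exact: divr_gt0.
rewrite -scaleNr; split; apply: rO; rewrite /ball /= sub0r ?opprK ?normrN gtr0_norm;
  lra.
Qed.

Lemma le_of_segment (R : realType) (x y b : R) :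
  (forall s, 0 < s -> s <= 1 -> (1 - s) * x + s * y <= b) -> x <= b.
Proof.
move=> h; rewrite leNgt; apply/negP => bx.
have yb : y <= b by have := h 1 ltr01 (lexx _); lra.
have xy : 0 < x - y by lra.
have := h ((x - b) / (2 * (x - y))).
have e : (x - b) / (2 * (x - y)) * (x - y) = (x - b) / 2.
  by field; rewrite gt_eqF.
have s0 : 0 < (x - b) / (2 * (x - y)) by rewrite divr_gt0 ?mulr_gt0 // subr_gt0.
have s1 : (x - b) / (2 * (x - y)) <= 1.
  by rewrite ler_pdivrMr ?mulr_gt0 //; lra.
by move=> /(_ s0 s1); lra.
Qed.

Section SharpConeTheory.
Variables (R : realType) (d : nat) (a : 'rV[R]_d) (O D : set 'rV[R]_d).
Hypotheses (a1 : dot a a = 1) (OD : sharp_cone a O D).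

Lemma cone_segment p o s : D p -> O o -> 0 < s -> s <= 1 ->
  O ((1 - s) *: p + s *: o).
Proof.
move=> Dp Oo s0 s1; rewrite addrC; apply: (cone_absorb OD).
  exact: (cone_scale_open OD).
by apply: (cone_scale OD) => //; lra.
Qed.

Lemma cone_dot_bound m :
  exists2 C, 0 <= C & forall p, D p -> `|dot p m| <= C * dot p a.
Proof.
have [C C0 CD] := cone_bound OD; have [M M0 MD] := dot_le_norm m.
exists (M * C) => [|p Dp]; first by rewrite mulr_ge0 // ltW.
by apply: le_trans (MD p) _; rewrite -mulrA ler_wpM2l // CD.
Qed.

Lemma cone_depth_gt0 o : O o -> 0 < dot o a.
Proof.
move=> Oo; have [r r0 [_ Or]] := open_dir a (cone_open OD) Oo.
have [C C0 /(_ _ (cone_sub OD Or))] := cone_bound OD.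
move=> /(le_trans (normr_ge0 _)); rewrite pmulr_rge0 // !dotE a1; lra.
Qed.

(** The projection of the section at depth 1 to a transversal axis [e].  Points
    of [D] are limits of points of [O] along segments, so the two cones have the
    same range, whereas every interior value is attained by [O] itself. *)
Lemma section_range e : dot e e = 1 -> dot e a = 0 ->
  exists alpha beta, [/\ alpha < beta,
    forall p, D p -> dot p a = 1 -> alpha <= dot p e <= beta &
    forall x, alpha < x < beta -> exists o, [/\ O o, dot o a = 1 & dot o e = x]].
Proof.
move=> e1 ea.
have [ o [Oo oa]] : exists o, O o /\ dot o a = 1.
  have [ o Oo] := cone_nonempty OD; have oa := cone_depth_gt0 Oo.
  exists ((dot o a)^-1 *: o); split.
    by apply: (cone_scale_open OD) => //; rewrite invr_gt0.
  by rewrite dotZl mulVf // gt_eqF.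
pose E := [set dot q e | q in [set q | O q /\ dot q a = 1]].
have [C C0 Ce] := cone_dot_bound e.
have Eb x : E x -> - C <= x <= C.
  move=> [q [Oq qa] <-]; rewrite -ler_norml.
  by have := Ce q (cone_sub OD Oq); rewrite qa mulr1.
have E0 : E !=set0 by exists (dot o e), o.
have has_s : has_sup E by split=> //; exists C => x /Eb/andP[].
have has_i : has_inf E by split=> //; exists (- C) => x /Eb/andP[].
have supE q : O q -> dot q a = 1 -> inf E <= dot q e <= sup E.
  move=> Oq qa; have Eq : E (dot q e) by exists q.
  by rewrite (ge_inf has_i.2 Eq) (ub_le_sup has_s.2 Eq).
have [r r0 [ O1 O2]] := open_dir e (cone_open OD) Oo.
exists (inf E), (sup E); split.
- have := supE _ O1; have := supE _ O2; rewrite !dotE e1 ea oa.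
  by move=> /(_ ltac:(lra)) /andP[? ?] /(_ ltac:(lra)) /andP[? ?]; lra.
- move=> p Dp pa.
  have h s : 0 < s -> s <= 1 -> inf E <= (1 - s) * dot p e + s * dot o e <= sup E.
    move=> s0 s1; rewrite -!dotZl -dotDl; apply: supE.
      exact: cone_segment.
    by rewrite !dotE pa oa; lra.
  apply/andP; split; last first.
    by apply: (@le_of_segment R _ (dot o e)) => s s0 s1; case/andP: (h s s0 s1).
  rewrite -lerN2; apply: (@le_of_segment R _ (- dot o e)) => s s0 s1.
  by case/andP: (h s s0 s1) => ? ?; lra.
- move=> x /andP[x1 x2].
  have := inf_adherent (eps := x - inf E) ltac:(lra) has_i.
  have := sup_adherent (eps := sup E - x) ltac:(lra) has_s.
  move=> [_ [q [Oq qa] <-] qx] [_ [q' [Oq' qa'] <-] qx'].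
  pose s := (x - dot q' e) / (dot q e - dot q' e).
  have D0 : 0 < dot q e - dot q' e by lra.
  have s0 : 0 < s by rewrite divr_gt0 //; lra.
  have s1 : s <= 1 by rewrite ler_pdivrMr //; lra.
  exists ((1 - s) *: q' + s *: q); split.
  + by apply: cone_segment => //; exact: (cone_sub OD).
  + by rewrite !dotE qa qa'; lra.
  + by rewrite !dotE /s; field; rewrite gt_eqF.
Qed.

(** The strips are centred on hyperplanes through the apex, so coning from depth
    1 up to depth [dot p a <= 1] only shrinks the distance to them.  The apex
    itself lies in every strip, which is why one strip is required. *)
Lemma boundary_strips_of_section (I : finType) (m : I -> 'rV[R]_d) (h : I -> R) :
  (0 < #|I|)%N -> (forall i, 0 < h i) ->
  (forall q, D q -> dot q a = 1 -> ~ O q -> exists i, `|dot q (m i)| < h i) ->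
  forall p, D p -> dot p a <= 1 -> ~ O p -> exists i, `|dot p (m i)| < h i.
Proof.
move=> /card_gt0P[i0 _] h0 H p Dp pa nOp.
have [C C0 /(_ p Dp) pC] := cone_bound OD.
have pa0 : 0 <= dot p a.
  by rewrite -(pmulr_rge0 _ C0); apply: le_trans pC.
move: pa0; rewrite le_eqVlt => /predU1P[pa0|pa0].
  move: pC; rewrite -pa0 mulr0 normr_le0 => /eqP ->.
  by exists i0; rewrite dot0l normr0.
have [|||i hi] := H ((dot p a)^-1 *: p).
- by apply: (cone_scale OD); rewrite // invr_ge0 ltW.
- by rewrite dotZl mulVf // gt_eqF.
- move=> Oq; apply: nOp.
  by rewrite -(scalerKV (a := dot p a) _ p) ?gt_eqF //; apply: (cone_scale_open OD).
- exists i; apply: le_lt_trans hi; rewrite dotZl normrM.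
  by rewrite ler_peMl // gtr0_norm ?invr_gt0 // invf_ge1.
Qed.
End SharpConeTheory.

(** * Covering the boundary of a sharp cone *)

(** The normals [m i] need not be unit vectors: norm at least 1 suffices to
    bound the width of the strip of half-height [h i] by [2 * h i]. *)
Definition boundary_covered (R : realType) (d : nat) (a : 'rV[R]_d)
    (O D : set 'rV[R]_d) :=
  exists (I : finType) (m : I -> 'rV[R]_d) (h : I -> R),
    [/\ forall i, 1 <= dot (m i) (m i), forall i, 0 < h i,
        \sum_i 2 * h i < 1 &
        forall p, D p -> dot p a <= 1 -> ~ O p ->
          exists i, `|dot p (m i)| < h i].

(** The section at depth 1 is an interval, so the boundary consists of the two
    rays over its end points and the half-height of the strips is arbitrary. *)
Lemma planar_boundary_covered (R : realType) (a : 'rV[R]_2) (O D : set 'rV[R]_2) :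
  dot a a = 1 -> sharp_cone a O D -> boundary_covered a O D.
Proof.
move=> a1 OD; have [e [e1 ea frame]] := plane_frame a1.
have ae : dot a e = 0 by rewrite dotC.
have [al [be [ab Dab Oab]]] := section_range a1 OD e1 ea.
pose m (b : bool) := e - (if b then be else al) *: a.
have m1 b : 1 <= dot (m b) (m b).
  rewrite /m !dotE a1 e1 ea ae; have := sqr_ge0 (if b then be else al); lra.
exists bool, m, (fun=> 8^-1); split=> //.
  by rewrite big_bool /=; lra.
apply: (boundary_strips_of_section OD); rewrite ?card_bool // => q Dq qa nOq.
have /andP[q1 q2] := Dab q Dq qa.
have mq b : dot q (m b) = dot q e - (if b then be else al).
  by rewrite /m !dotE qa mulr1.
have [qb|qb] := ltP (dot q e) be; last first.
  exists true; rewrite mq (_ : _ - _ = 0) ?normr0 ?invr_gt0 //; lra.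
have [qa'|qa'] := ltP al (dot q e); last first.
  exists false; rewrite mq (_ : _ - _ = 0) ?normr0 ?invr_gt0 //; lra.
have [ o [Oo oa oe]] := Oab (dot q e) ltac:(by rewrite qa' qb).
case: nOq; suff -> : q = o by [].
by apply/subr0_eq/frame; rewrite dotBl ?qa ?oa ?oe subrr.
Qed.

Lemma mul_sup_le (R : realType) (E : set R) (c b : R) :
  has_sup E -> 0 <= c -> (forall v, E v -> c * v <= b) -> c * sup E <= b.
Proof.
move=> [E0 Eb]; rewrite le_eqVlt => /predU1P[<-|c0] h.
  by have [v /h] := E0; rewrite !mul0r.
rewrite mulrC -ler_pdivlMr //; apply: ge_sup => // v /h.
by rewrite ler_pdivlMr // mulrC.
Qed.

(** Seen in the coordinates along [e] and [f], the section of [O] at depth 1 is a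
    bounded planar convex set.  A boundary point on its upper side has the
    supremum [g] of the fibre as [f]-coordinate, and [g] is concave.  The strip
    around the line y = A x + B cones to the strip with normal
    [f - A *: e - B *: a], whose norm is at least 1 by orthogonality.  The range is
    cut by [eta] twice: [g] is only defined on the open range, and its increments
    are only controlled away from the ends. *)
Lemma upper_graph_covered (R : realType) (d : nat) (a e f : 'rV[R]_d)
    (O D : set 'rV[R]_d) (al be eta kappa : R) :
  dot a a = 1 -> dot e e = 1 -> dot f f = 1 -> dot f a = 0 -> dot f e = 0 -> dot e a = 0 ->
  sharp_cone a O D ->
  (forall x, al < x < be -> exists o, [/\ O o, dot o a = 1 & dot o e = x]) ->
  0 < eta -> 4 * eta < be - al -> 0 < kappa ->
  exists (n : nat) (m : 'I_n -> 'rV[R]_d) (h : 'I_n -> R),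
    [/\ forall i, 1 <= dot (m i) (m i), forall i, 0 < h i, \sum_i h i < kappa &
        forall q, D q -> dot q a = 1 ->
          al + 2 * eta <= dot q e <= be - 2 * eta ->
          (forall o, O o -> dot o a = 1 -> dot o e = dot q e ->
             dot o f <= dot q f) ->
          exists i, `|dot q (m i)| < h i].
Proof.
move=> a1 e1 f1 fa fe ea OD fibre eta0 ab kappa0.
have [C C0 Cf] := cone_dot_bound OD f.
pose E x := [set dot o f | o in [set o | [/\ O o, dot o a = 1 & dot o e = x]]].
have Eb x v : E x v -> `|v| <= C.
  move=> [ o [Oo oa _] <-].
  by have := Cf o (cone_sub OD Oo); rewrite oa mulr1.
have hasE x : al < x < be -> has_sup (E x).
  move=> /fibre[ o oP]; split; first by exists (dot o f), o.
  by exists C => v /Eb; rewrite ler_norml => /andP[].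
pose g x := sup (E x).
have gE x v : al < x < be -> E x v -> v <= g x.
  by move=> /hasE[_ ?]; exact: ub_le_sup.
have [|||||n [A [B [h [h0 hk hg]]]]] :=
    @concave_graph_strips R g (al + eta) (be - eta) C eta kappa => //.
- by lra.
- move=> x /andP[x1 x2]; have xab : al < x < be by apply/andP; split; lra.
  have [[v Ev] Esup] := hasE x xab.
  rewrite ler_norml; apply/andP; split.
    apply: le_trans (gE x v xab Ev).
    by have := Eb x v Ev; rewrite ler_norml => /andP[].
  by apply: ge_sup => [|w /Eb]; [exists v|rewrite ler_norml => /andP[]].
- move=> x y z ax xy yz zb.
  have [xz|xz] := eqVneq x z.
    have -> : y = x by apply/le_anti; rewrite xy xz yz.
    by rewrite xz subrr !mulr0 addr0.
  have {}xz : 0 < z - x by rewrite subr_gt0 lt_neqAle xz (le_trans xy).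
  have xI : al < x < be by apply/andP; split; lra.
  have yI : al < y < be by apply/andP; split; lra.
  have zI : al < z < be by apply/andP; split; lra.
  rewrite -lerBrDr mulrC; apply: mul_sup_le; [exact: hasE|lra|].
  move=> v [ o1 [Oo1 o1a o1e] <-].
  rewrite lerBrDr addrC -lerBrDr mulrC; apply: mul_sup_le; [exact: hasE|lra|].
  move=> w [ o2 [Oo2 o2a o2e] <-].
  rewrite lerBrDr.
  have [yx|yx] := eqVneq y x.
    rewrite yx subrr mul0r add0r mulrC ler_pM2r //.
    by apply: gE => //; exists o1.
  pose s := (y - x) / (z - x).
  have s0 : 0 < s by rewrite divr_gt0 // subr_gt0 lt_neqAle eq_sym yx.
  have s1 : s <= 1 by rewrite ler_pdivrMr // mul1r lerD2r.
  have : (1 - s) * dot o1 f + s * dot o2 f <= g y.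
    apply: gE => //; exists ((1 - s) *: o1 + s *: o2); last by rewrite !dotE.
    split; first by apply: (cone_segment OD) => //; exact: (cone_sub OD).
      by rewrite !dotE o1a o2a; ring.
    by rewrite !dotE o1e o2e /s; field; rewrite gt_eqF.
  rewrite -(ler_pM2r xz); congr (_ <= _).
  by rewrite /s; field; rewrite gt_eqF.
exists n, (fun i => f - A i *: e - B i *: a), h; split=> // [i|q Dq qa qe top].
  have [af ef] : dot a f = 0 /\ dot e f = 0 by rewrite ![dot _ f]dotC.
  have ae : dot a e = 0 by rewrite dotC.
  rewrite !dotE a1 e1 f1 fa fe ea af ef ae.
  have := sqr_ge0 (A i); have := sqr_ge0 (B i); lra.
have qI : al < dot q e < be by case/andP: qe => ? ?; apply/andP; split; lra.
(* [dot q f] is at most the supremum since [q] is a limit of points of [O] in its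
   own fibre. *)
have gq : g (dot q e) = dot q f.
  apply/le_anti/andP; split.
    apply: ge_sup; first by case: (hasE _ qI).
    by move=> _ [ o [Oo oa oe] <-]; exact: top.
  have [ o [Oo oa oe]] := fibre _ qI.
  apply: (@le_of_segment R _ (dot o f)) => s s0 s1.
  apply: gE => //; exists ((1 - s) *: q + s *: o); last by rewrite !dotE.
  split; first exact: (cone_segment OD).
    by rewrite !dotE qa oa; ring.
  by rewrite !dotE oe; ring.
have [|i hi] := hg (dot q e); first by case/andP: qe => ? ?; apply/andP; split; lra.
exists i; move: hi; rewrite gq.
have -> // : dot q f - (A i * dot q e + B i) = dot q (f - A i *: e - B i *: a).
by rewrite !dotE qa; ring.
Qed.

(** A point of [D] strictly between two points of [O] in its fibre over the
    [e]-axis would belong to [O]; hence a boundary point is on the upper or the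
    lower side, the latter being the upper side for [- f].  With [eta] at most
    1/32 the two end strips have total width at most 1/4, and each of the two
    graphs costs less than 1/4. *)
Lemma spatial_boundary_covered (R : realType) (a : 'rV[R]_3) (O D : set 'rV[R]_3) :
  dot a a = 1 -> sharp_cone a O D -> boundary_covered a O D.
Proof.
move=> a1 OD; have [e [f [e1 f1 [ea fa fe frame]]]] := space_frame a1.
have ae : dot a e = 0 by rewrite dotC.
have [al [be [ab Dab Oab]]] := section_range a1 OD e1 ea.
pose eta := Num.min (32^-1) ((be - al) / 8).
have eta0 : 0 < eta by rewrite lt_min; apply/andP; split; lra.
have eta1 : eta <= 32^-1 by rewrite ge_min lexx.
have eta2 : 4 * eta < be - al.
  have : eta <= (be - al) / 8 by rewrite ge_min lexx orbT.
  by lra.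
have [n1 [m1 [h1 [m1_ge h1_gt sum1 cov1]]]] := @upper_graph_covered R 3 a e f O D
  al be eta 8^-1 a1 e1 f1 fa fe ea OD Oab eta0 eta2 ltac:(by rewrite invr_gt0).
have [|||n2 [m2 [h2 [m2_ge h2_gt sum2 cov2]]]] := @upper_graph_covered R 3 a e (- f) O D
  al be eta 8^-1 a1 e1 _ _ _ ea OD Oab eta0 eta2 ltac:(by rewrite invr_gt0).
- by rewrite !dotE opprK.
- by rewrite dotNl fa oppr0.
- by rewrite dotNl fe oppr0.
pose m (i : bool + ('I_n1 + 'I_n2)) := match i with
  | inl b => e - (if b then be else al) *: a
  | inr (inl i) => m1 i
  | inr (inr i) => m2 i
  end.
pose h (i : bool + ('I_n1 + 'I_n2)) := match i with
  | inl _ => 2 * eta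
  | inr (inl i) => h1 i
  | inr (inr i) => h2 i
  end.
have h0 i : 0 < h i by case: i => [b|[i|i]] //=; rewrite mulr_gt0.
exists _, m, h; split=> //.
- move=> [b|[i|i]] //=; set c := if b then _ else _.
  rewrite !dotE a1 e1 ea ae; have := sqr_ge0 c; lra.
- rewrite !big_sumType /= big_bool -!mulr_sumr /=.
  move: sum1 sum2; lra.
apply: (boundary_strips_of_section OD) => //.
  by apply/card_gt0P; exists (inl true).
move=> q Dq qa nOq; have /andP[q1 q2] := Dab q Dq qa.
have mq b : dot q (m (inl b)) = dot q e - (if b then be else al).
  by rewrite /m !dotE qa mulr1.
have [qb|qb] := leP (dot q e) (be - 2 * eta); last first.
  by exists (inl true); rewrite mq ltr_norml /=; apply/andP; split; lra.
have [qa'|qa'] := leP (al + 2 * eta) (dot q e); last first.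
  by exists (inl false); rewrite mq ltr_norml /=; apply/andP; split; lra.
have qI : al + 2 * eta <= dot q e <= be - 2 * eta by rewrite qa' qb.
have [[ o [Oo oa oe of_]]|top] :=
    pselect (exists o, [/\ O o, dot o a = 1, dot o e = dot q e & dot q f < dot o f]);
    last first.
  have [|i hi] := cov1 q Dq qa qI; last by exists (inr (inl i)).
  by move=> o Oo oa oe; rewrite leNgt; apply/negP => ?; apply: top; exists o.
have [|i hi] := cov2 q Dq qa qI; last by exists (inr (inr i)).
move=> o' Oo' o'a o'e; rewrite !dotNr lerN2 leNgt; apply/negP => o'f.
apply: nOq; pose s := (dot q f - dot o' f) / (dot o f - dot o' f).
have D0 : 0 < dot o f - dot o' f by lra.
have s0 : 0 < s by rewrite divr_gt0 //; lra.
have s1 : s <= 1 by rewrite ler_pdivrMr //; lra.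
suff -> : q = (1 - s) *: o' + s *: o.
  by apply: (cone_segment OD) => //; exact: (cone_sub OD).
apply/subr0_eq/frame; rewrite dotBl dotDl !dotZl.
- by rewrite qa oa o'a; ring.
- by rewrite oe o'e; ring.
- by rewrite /s; field; rewrite gt_eqF.
Qed.

(** * The cones of a convex body at a spike *)

Lemma closure_map (T U : topologicalType) (f : T -> U) (A : set T) (B : set U) :
  continuous f -> (forall y, A y -> B (f y)) ->
  forall y, closure A y -> closure B (f y).
Proof.
move=> cf AB y clA V /cf/clA[z [Az Vz]]; exists (f z); split=> //; exact: AB.
Qed.

Lemma affine_continuous (R : realType) (V : normedModType R) (v : V) (r : R) :
  continuous (fun p : V => v + r *: p).
Proof.
move=> p; apply: (@continuousD _ _ _ (fun=> v) (fun p : V => r *: p)).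
  exact: cst_continuous.
exact: scaler_continuous.
Qed.

Lemma nbhs_affine (R : realType) (V : normedModType R) (v p : V) (r : R) A :
  nbhs (v + r *: p) A -> nbhs p [set q | A (v + r *: q)].
Proof. by move=> /(@affine_continuous _ _ v r p). Qed.

Lemma convex_setP (R : realType) (d : nat) (K : set 'rV[R]_d) (x y : 'rV[R]_d) s :
  convex_set (M := 'rV[R]_d) K -> K x -> K y -> 0 <= s -> s <= 1 ->
  K (s *: x + (1 - s) *: y).
Proof.
move=> cK Kx Ky s0 s1.
have := cK x y (Itv01 s0 s1); rewrite !inE; exact.
Qed.

Lemma convex_shrink (R : realType) (d : nat) (K : set 'rV[R]_d) (x w : 'rV[R]_d)
    (b r : R) :
  convex_set (M := 'rV[R]_d) K -> K x -> 0 < b -> b <= r ->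
  K (x + r *: w) -> K (x + b *: w).
Proof.
move=> cK Kx b0 br Kw; have r0 : 0 < r by exact: lt_le_trans br.
have -> : x + b *: w = (b / r) *: (x + r *: w) + (1 - b / r) *: x.
  by apply/rowP => i; rewrite !mxE; field; rewrite gt_eqF.
apply: convex_setP => //; first by rewrite divr_ge0 // ltW.
by rewrite ler_pdivrMr // mul1r.
Qed.

Lemma interior_convex (R : realType) (d : nat) (K : set 'rV[R]_d)
    (x y : 'rV[R]_d) s :
  convex_set (M := 'rV[R]_d) K -> interior K x -> K y -> 0 < s -> s <= 1 ->
  interior K (s *: x + (1 - s) *: y).
Proof.
move=> cK Kx Ky s0 s1; set p := _ + _.
pose f q : 'rV[R]_d := - (s^-1 * (1 - s)) *: y + s^-1 *: q.
have fK q : s *: f q + (1 - s) *: y = q.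
  by rewrite scalerDr !scalerA mulrN mulrA divff ?gt_eqF // mul1r scale1r
    addrAC scaleNr addNr add0r.
(* [f] inverts the homothety of centre [y] and ratio [s], hence pulls
   neighbourhoods of [x] back to neighbourhoods of [p]. *)
have fp : f p = x.
  apply: (scalerI (a := s)); first by rewrite gt_eqF.
  by apply: (addIr ((1 - s) *: y)); rewrite fK.
have : nbhs p [set q | K (f q)] by apply: nbhs_affine; rewrite -/(f p) fp.
by apply: filterS => q /= Kq; rewrite -(fK q); apply: convex_setP => //; apply: ltW.
Qed.

(** The open sets where [f] exceeds 1/(n+1) increase and cover [A]. *)
Lemma compact_pos_bound (R : realType) (T : topologicalType) (A : set T)
    (f : T -> R) :
  compact A -> continuous f -> (forall x, A x -> 0 < f x) ->
  exists2 c, 0 < c & forall x, A x -> c <= f x.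
Proof.
move=> /compact_near_coveringP cA cf f0.
have : \forall n \near \oo, A `<=` [set x | n.+1%:R^-1 < f x].
  apply: (cA nat \oo (fun n x => n.+1%:R^-1 < f x)) => x /f0 fx0.
  have fx2 : 0 < f x / 2 by rewrite divr_gt0.
  exists ([set y | f x / 2 < f y], [set n | n.+1%:R^-1 < f x / 2]).
    split; last exact: (near_infty_natSinv_lt (PosNum fx2)).
    apply: (cf x [set v | f x / 2 < v]); apply: open_nbhs_nbhs; split.
      exact: open_gt.
    by rewrite /=; lra.
  by move=> [y n] [/= h1 h2]; exact: lt_trans h2 h1.
move=> [N _ /(_ N (leqnn N)) h]; exists (N.+1%:R^-1) => [|x /h/ltW//].
by rewrite invr_gt0 ltr0n.
Qed.

(** Both cones have their apex at the origin, although the body has its spike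
    at [x]. *)
Definition open_cone (R : realType) (d : nat) (K : set 'rV[R]_d) (x : 'rV[R]_d) :=
  [set p | exists2 r : R, 0 < r & interior K (x + r *: p)].

Definition closed_cone (R : realType) (d : nat) (K : set 'rV[R]_d) (x : 'rV[R]_d) :=
  [set p | tangent_cone K x (x + p)].

Lemma closed_coneZ (R : realType) (d : nat) (K : set 'rV[R]_d) (x : 'rV[R]_d) c p :
  0 <= c -> closed_cone K x p -> closed_cone K x (c *: p).
Proof.
move=> c0; rewrite /closed_cone /= => Dp.
have -> : x + c *: p = (x - c *: x) + c *: (x + p).
  by rewrite scalerDr addrA subrK.
apply: closure_map (@affine_continuous _ _ _ _) _ _ Dp => _ [k Kk [b b0 ->]].
exists k => //; exists (c * b); first exact: mulr_ge0.
by rewrite scalerDr addrA subrK scalerA.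
Qed.

Lemma closed_closed_cone (R : realType) (d : nat) (K : set 'rV[R]_d) (x : 'rV[R]_d) :
  closed (closed_cone K x).
Proof.
have := @affine_continuous R 'rV[R]_d x 1 => /continuous_closedP/(_ _ (@closed_closure _ _)).
move=> /(_ [set z | exists2 y, K y & exists2 a : R, 0 <= a & z = x + a *: (y - x)]).
rewrite /closed_cone /tangent_cone; congr closed.
by apply/seteqP; split=> p /=; rewrite scale1r.
Qed.

Lemma convex_sub_closed_cone (R : realType) (d : nat) (K : set 'rV[R]_d)
  (x k : 'rV[R]_d) : K k -> closed_cone K x (k - x).
Proof.
by move=> Kk; apply: subset_closure; exists k => //; exists 1; rewrite ?scale1r.
Qed.

(** In [o + c *: (k - x)] both summands are multiples of vectors from [x] to
    points of [K]; with [s = (1 + r * c)^-1] a multiple of the sum is the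
    corresponding convex combination of an interior point and of [k]. *)
Lemma open_coneD (R : realType) (d : nat) (K : set 'rV[R]_d) (x o k : 'rV[R]_d) c :
  convex_set (M := 'rV[R]_d) K -> open_cone K x o -> K k -> 0 <= c ->
  open_cone K x (o + c *: (k - x)).
Proof.
move=> cK [r r0 Ko] Kk c0.
have rc : 0 < 1 + r * c by rewrite ltr_pwDl // mulr_ge0 // ltW.
pose s := (1 + r * c)^-1.
have s0 : 0 < s by rewrite invr_gt0.
have s1 : s <= 1.
  by rewrite invf_le1 // lerDl mulr_ge0 // ltW.
exists (s * r); first exact: mulr_gt0.
have sE : 1 - s = s * r * c by rewrite /s; field; rewrite gt_eqF.
have -> : x + (s * r) *: (o + c *: (k - x)) = s *: (x + r *: o) + (1 - s) *: k.
  apply/rowP => i; rewrite !mxE mulrDr [_ * (c * _)]mulrA -sE; ring.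
exact: interior_convex.
Qed.

(** Boundedness of the sections is where spikiness enters: the unit vectors of
    the closed cone form a compact set on which the depth is positive, hence
    bounded below. *)
Lemma vertex_sharp_cone (R : realType) (d : nat) (K : set 'rV[R]_d)
    (a x : 'rV[R]_d) :
  convex_set (M := 'rV[R]_d) K -> interior K !=set0 -> K x ->
  (forall k, K k -> dot x a <= dot k a) ->
  (forall y, tangent_cone K x y -> dot y a = dot x a -> y = x) ->
  sharp_cone a (open_cone K x) (closed_cone K x).
Proof.
move=> cK [z Kz] Kx low sharp.
have oO : open (open_cone K x).
  rewrite openE => p [r r0 Kp].
  have : nbhs p [set q | interior K (x + r *: q)].
    by apply: nbhs_affine; apply: nbhs_interior.
  by apply: filterS => q Kq; exists r.
split.
- exact: oO.
- by exists (z - x), 1 => //; rewrite scale1r subrKC.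
- move=> o [r r0 /interior_subset Ko].
  have rn : r != 0 by rewrite gt_eqF.
  rewrite -(scalerK rn o); apply: closed_coneZ.
    by rewrite invr_ge0 ltW.
  by rewrite -(addKr x (r *: o)) [X in closed_cone _ _ X]addrC; apply: convex_sub_closed_cone.
- move=> o p Oo Dp.
  (* Move [p] to a nearby point of the cone spanned by [K] and correct [o] by
     the difference: [O] is open, so the corrected point stays in it. *)
  have : nbhs (x + p) [set y | open_cone K x ((o + (x + p)) + (-1) *: y)].
    apply: nbhs_affine; apply: open_nbhs_nbhs; split=> //.
    by rewrite scaleN1r addrK.
  move=> /Dp[_ [[k Kk [c c0 ->]]]] /= Oy.
  have := open_coneD cK Oy Kk c0; congr (open_cone K x _).
  by apply/rowP => i; rewrite !mxE; ring.
- move=> c o c0 [r r0 Ko]; exists (r / c); first exact: divr_gt0.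
  by rewrite scalerA divfK ?gt_eqF.
- by move=> c p; exact: closed_coneZ.
have D0 p : closed_cone K x p -> 0 <= dot p a.
  have cl : closed [set y | dot x a <= dot y a].
    apply: (continuous_closedP _).1 (@dot_continuous R d a) _ (@closed_ge _ _).
  move=> Dp; suff : [set y | dot x a <= dot y a] (x + p).
    by rewrite /= dotDl lerDl.
  rewrite (iffLR (closure_id _) cl); apply: closure_subset Dp.
  move=> _ [k Kk [c c0 ->]] /=; rewrite !dotE lerDl mulr_ge0 //.
  by have := low k Kk; lra.
have D1 p : closed_cone K x p -> p != 0 -> 0 < dot p a.
  move=> Dp p0; rewrite lt_neqAle D0 // andbT eq_sym.
  apply: contra p0 => /eqP pa; apply/eqP.
  have := sharp _ Dp; rewrite dotDl pa addr0 => /(_ erefl) /(canRL (addKr _)) ->.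
  by rewrite addNr.
pose S := closed_cone K x `&` [set p | `|p| = 1].
have cS : compact S.
  apply: bounded_closed_compact.
    by exists 1; split=> // M M1 p [_ /= ->]; exact: ltW.
  apply: closedI; first exact: closed_closed_cone.
  exact: (iffLR (continuous_closedP _) (@norm_continuous R 'rV[R]_d) _
    (@closed_eq R 1)).
have [||c c0 hc] := @compact_pos_bound R 'rV[R]_d S (fun p => dot p a) cS.
- exact: dot_continuous.
- move=> p [Dp /= p1]; apply: D1 => //; rewrite -normr_eq0 p1; exact: oner_neq0.
exists c^-1; first by rewrite invr_gt0.
move=> p Dp; have [->|p0] := eqVneq p 0; first by rewrite normr0 dot0l mulr0.
have np : 0 < `|p| by rewrite normr_gt0.
rewrite mulrC ler_pdivlMr //.
have : c <= dot (`|p|^-1 *: p) a.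
  apply: hc; split; first by apply: closed_coneZ => //; rewrite invr_ge0 ltW.
  by rewrite /= normrZ gtr0_norm ?invr_gt0 // mulVf // gt_eqF.
by rewrite dotZl mulrC ler_pdivlMr // mulrC.
Qed.

(** Writing [b] for 1/(n+1), the conclusion places [F] in the multiple of [K] by
    [b^-1] centred at [x] and shifted by [b *: z].  Near a point of [F] the shift
    vanishes as n grows while the dilate of [K] only grows, and compactness
    makes the choice of n uniform.  The shift is there to leave room for an inward
    translation of the homothet. *)
Lemma compact_sub_open_cone (R : realType) (d : nat) (K : set 'rV[R]_d)
    (x z : 'rV[R]_d) (F : set 'rV[R]_d) :
  convex_set (M := 'rV[R]_d) K -> K x -> compact F -> F `<=` open_cone K x ->
  \forall n \near \oo, forall p, F p ->
    K (x + n.+1%:R^-1 *: (p - n.+1%:R^-1 *: z)).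
Proof.
move=> cK Kx /compact_near_coveringP cF FO.
apply: (cF nat \oo (fun n p => K (x + n.+1%:R^-1 *: (p - n.+1%:R^-1 *: z)))).
move=> p /FO[r r0 Kp].
have cvg0 : (x + r *: (q.1 - q.2.+1%:R^-1 *: z)) @[q --> (nbhs p, \oo)]
    --> x + r *: (p - 0 *: z).
  apply: cvgD; first exact: cvg_cst.
  apply: cvgZl_tmp; apply: cvgB; first exact: cvg_fst.
  apply: cvgZr_tmp; apply: cvg_comp cvg_harmonic; exact: cvg_snd.
have near1 : \forall q \near (nbhs p, \oo),
    K (x + r *: (q.1 - q.2.+1%:R^-1 *: z)).
  by apply: cvg0; rewrite scale0r subr0.
have near2 : \forall q \near (nbhs p, \oo), q.2.+1%:R^-1 < r.
  apply: (@cvg_snd _ _ (nbhs p) \oo _ [set n : nat | n.+1%:R^-1 < r]).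
  exact: (near_infty_natSinv_lt (PosNum r0)).
apply: filterS2 near1 near2 => -[q n] /= Kq nr.
by apply: (convex_shrink cK Kx _ (ltW nr)) => //; rewrite invr_gt0 ltr0n.
Qed.

(** * Planks *)

Lemma strip_plank (R : realType) (d : nat) (m x : 'rV[R]_d) (h : R) :
  1 <= dot m m -> 0 < h ->
  exists P : plank R d, plank_width P <= 2 * h /\
    forall p, `|dot (p - x) m| <= h -> plank_set P p.
Proof.
move=> m1 h0; pose c := Num.sqrt (dot m m).
have c1 : 1 <= c by rewrite -[leLHS]sqrtr1 ler_wsqrtr.
have c0 : 0 < c by lra.
have un : unit_sphere (c^-1 *: m).
  rewrite /unit_sphere /= !dotE mulrA -invfM -expr2 sqr_sqrtr; last by lra.
  by rewrite mulVf // gt_eqF //; lra.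
have lh : c^-1 * (dot x m - h) < c^-1 * (dot x m + h).
  by rewrite ltr_pM2l ?invr_gt0 //; lra.
exists (Plank un lh); split.
  rewrite /plank_width /= -mulrBr ler_pdivrMl //; nra.
move=> p; rewrite ler_norml /plank_set /= dotZr dotBl => /andP[? ?].
by rewrite !ler_pM2l ?invr_gt0 //; apply/andP; split; lra.
Qed.

Lemma finite_plank_family (R : realType) (d : nat) (I : finType)
    (P : I -> plank R d) (A : set 'rV[R]_d) (w : R) :
  \sum_i plank_width (P i) < w ->
  (forall p, A p -> exists i, plank_set (P i) p) ->
  exists (n : nat) (Q : 'I_n -> plank R d),
    A `<=` \bigcup_i plank_set (Q i) /\ \sum_(i < n) plank_width (Q i) < w.
Proof.
move=> Pw AP; exists #|I|, (fun i => P (enum_val i)); split.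
  by move=> p /AP[i Pi]; exists (enum_rank i) => //; rewrite enum_rankK.
by move: Pw; rewrite (reindex _ (onW_bij _ (enum_val_bij I))).
Qed.

Lemma cone_boundary_covered (R : realType) (d : nat) (a : 'rV[R]_d)
    (O D : set 'rV[R]_d) :
  d = 2%N \/ d = 3%N -> dot a a = 1 -> sharp_cone a O D -> boundary_covered a O D.
Proof.
case=> dE; subst d; [exact: planar_boundary_covered|exact: spatial_boundary_covered].
Qed.

(** Since the strips are open and the sections of [D] are bounded, what they
    leave of the truncated cone is closed and bounded. *)
Lemma compact_truncated_core (R : realType) (d : nat) (a : 'rV[R]_d)
    (O D : set 'rV[R]_d) (I : finType) (m : I -> 'rV[R]_d) (h : I -> R) :
  closed D -> sharp_cone a O D ->
  compact [set p | [/\ D p, dot p a <= 1 & forall i, h i <= `|dot p (m i)|]].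
Proof.
move=> cD OD; have [C C0 CD] := cone_bound OD.
apply: bounded_closed_compact.
  exists C; split=> [|M CM p [Dp pa _]]; first exact: num_real.
  by apply: le_trans (ltW CM); apply: le_trans (CD p Dp) _; rewrite ger_pMr.
rewrite (_ : [set p | _] = D `&` [set p | dot p a <= 1] `&`
    \bigcap_(i in [set: I]) [set p | h i <= `|dot p (m i)|]); last first.
  apply/seteqP; split=> [p [Dp pa hp]|p [[Dp pa] hp]].
    by split=> [|i _]; [split|exact: hp].
  by split=> // i; exact: hp.
apply: closedI; first apply: closedI => //.
- exact: (iffLR (continuous_closedP _) (@dot_continuous R d a) _ (@closed_le R 1)).
- apply: closed_bigI => i _.
  apply: (iffLR (continuous_closedP (fun p : 'rV[R]_d => `|dot p (m i)|)) _ _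
    (@closed_ge R (h i))) => p.
  apply: (@continuous_comp _ _ _ (fun p : 'rV[R]_d => dot p (m i)) Num.norm).
    exact: dot_continuous.
  exact: (@norm_continuous R R).
Qed.

(** * The covering of the spiky body *)

Theorem theorem2 (R : realType) (d : nat) (hd : d = 2%N \/ d = 3%N)
    (K : set 'rV[R]_d) (hK : convex_body K)
    (hspiky : exists u : 'rV[R]_d, minimal_width_direction K u /\ spiky K u)
    (e : R) (he0 : 0 < e) (he1 : e < 1) :
  exists y : 'rV[R]_d,
    homothet e K y `<=` interior K /\
    exists (n : nat) (P : 'I_n -> plank R d),
      K `\` homothet e K y `<=` \bigcup_i plank_set (P i) /\
      \sum_(i < n) plank_width (P i) < minimal_width K.
Proof.
have [cK _ [z Kz]] := hK.
have [u [[P0 [[KP0 wP0] Pu]] [x [_ KH TH]]]] := hspiky.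
have uu : dot u u = 1 by rewrite -Pu; exact: normal_unit.
have [Kx xh] : (K `&` supporting_hyperplane K u) x by rewrite KH.
set w := minimal_width K in wP0 *.
have KP k : K k -> lo P0 <= dot k u <= hi P0 by move=> /KP0; rewrite /plank_set /= Pu.
have Kh k : K k -> dot k u <= dot x u.
  move=> Kk; rewrite xh; apply: ub_le_sup; last by exists k.
  by exists (hi P0) => _ [k' /KP/andP[_ ?] <-].
have Kl k : K k -> dot x u - w <= dot k u.
  move=> /KP/andP[lk _]; have /andP[_ xhi] := KP x Kx.
  by move: wP0; rewrite /plank_width => ?; lra.
have w0 : 0 < w by rewrite -wP0 /plank_width subr_gt0; exact: lo_lt_hi.
pose a := - u; have a1 : dot a a = 1 by rewrite /a !dotE opprK.
have ua p : dot p a = - dot p u by rewrite /a dotNr.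
(* Touching the supporting hyperplane only at [x] is exactly what
   [vertex_sharp_cone] asks of the tangent cone. *)
have sc : sharp_cone a (open_cone K x) (closed_cone K x).
  apply: vertex_sharp_cone => //; first by exists z.
    by move=> k /Kh; rewrite !ua lerN2.
  move=> y Ty; rewrite !ua => /oppr_inj yx.
  have : (tangent_cone K x `&` supporting_hyperplane K u) y.
    by split=> //; rewrite /supporting_hyperplane /= yx.
  by rewrite TH.
have [I [m [h [m1 h0 hsum hcov]]]] := cone_boundary_covered hd a1 sc.
pose F := [set p | [/\ closed_cone K x p, dot p a <= 1 &
                       forall i, h i <= `|dot p (m i)|]].
have cF : compact F := 
  compact_truncated_core (m := m) (h := h) (@closed_closed_cone R d K x) sc.
have FO : F `<=` open_cone K x.
  move=> p [Dp pa hp]; apply: contrapT => nOp.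
  by have [i] := hcov p Dp pa nOp; rewrite ltNge hp.
have [b [b0 b1 bw be bF]] : exists b : R, [/\ 0 < b, b <= 1, b < w, b < 1 - e &
    forall p, F p -> K (x + b *: (p - b *: (z - x)))].
  have e1 : 0 < 1 - e by rewrite subr_gt0.
  have [N _ /(_ N (leqnn N))[? [? ?]]] :=
    filterI (compact_sub_open_cone (z - x) cK Kx cF FO)
      (filterI (near_infty_natSinv_lt (PosNum w0))
        (near_infty_natSinv_lt (PosNum e1))).
  exists N.+1%:R^-1; split=> //.
  by rewrite invf_le1 ?ltr0n // ler1n.
(* [t] is the depth above which the strips act, [del] the inward shift of the
   spike: scaling [K / b] by [t] gives ratio [e], and the shift by [b *: (z - x)]
   becomes one by [del *: (z - x)]. *)
pose t := e * b; pose del := t * b.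
have t0 : 0 < t by rewrite mulr_gt0.
have tw : t < w by apply: lt_trans bw; rewrite /t; nra.
have del0 : 0 < del by rewrite mulr_gt0.
have del1 : del < 1 - e by apply: le_lt_trans be; rewrite /del /t; nra.
exists ((1 - e) *: x + del *: (z - x)); split.
  move=> _ [k Kk <-].
  (* The weight of [z] makes the point interior; the remaining weight 1 - del is
     at least [e], so it can be shared between [k] and [x]. *)
  have D0 : 0 < 1 - del by lra.
  have -> : e *: k + ((1 - e) *: x + del *: (z - x)) =
      del *: z + (1 - del) *: (e / (1 - del) *: k + (1 - e / (1 - del)) *: x).
    by apply/rowP => i; rewrite !mxE; field; rewrite gt_eqF.
  apply: interior_convex => //; last by lra.
  apply: convex_setP => //; first by rewrite divr_ge0 // ltW.
  by rewrite ler_pdivrMr //; lra.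
have bottom : dot x u - w < dot x u - t by rewrite ltrD2l ltrN2.
have th0 i : 0 < t * h i by rewrite mulr_gt0.
have [Q QP] := choice (fun i => strip_plank x (m1 i) (th0 i)).
pose P (j : unit + I) := match j with
  | inl _ => Plank uu bottom
  | inr i => Q i
  end.
apply: (@finite_plank_family R d _ P).
  rewrite big_sumType /= big_const card_unit /= addr0 {1}/plank_width /=.
  have : \sum_i plank_width (Q i) <= t * \sum_i 2 * h i.
    rewrite mulr_sumr; apply: ler_sum => i _; rewrite mulrCA; exact: (QP i).1.
  have : t * \sum_i 2 * h i < t * 1 by rewrite ltr_pM2l.
  by lra.
move=> p [Kp nKp].
have [pt|pt] := leP (dot p u) (dot x u - t).
  by exists (inl tt); rewrite /P /plank_set /= pt Kl.
have [[i hi]|nohi] := pselect (exists i, `|dot (p - x) (m i)| <= t * h i).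
  by exists (inr i); apply: (QP i).2.
case: nKp; pose q := t^-1 *: (p - x).
have Fq : F q.
  split; first by apply: closed_coneZ; [rewrite invr_ge0 ltW|exact: convex_sub_closed_cone].
    by rewrite /q dotZl ua dotBl mulrC ler_pdivrMr //; lra.
  move=> i; rewrite leNgt; apply/negP => hi; apply: nohi; exists i.
  move: hi; rewrite /q dotZl normrM gtr0_norm ?invr_gt0 //.
  by rewrite mulrC ltr_pdivrMr // mulrC => /ltW.
exists (x + b *: (q - b *: (z - x))); first exact: bF.
apply/rowP => i; rewrite /q /del /t !mxE; field.
by rewrite !gt_eqF.
Qed.
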